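(* For the Pulse update on the complete directed loopless graph $K_n^\rightarrow$, the maximum transient time satisfies $$T(n)\leq 3.$$ Thus the maximum transient time is bounded independently of $n$; in particular, $T(n)=O(1)$.
   Context: $K_n^\rightarrow$ denotes the complete directed graph on $n$ vertices (vertex set $V$) with no self-loops: for every pair of vertices $u\neq v$ the edge $u\to v$ is present. The Pulse update on a loopless directed graph $(V,E)$ acts on states $x_t:V\to\{0,1\}$ synchronously: with $k_t(v)=\sum_{u:(u,v)\in E}x_t(u)$, one sets $x_{t+1}(v)=1$ if $k_t(v)$ is a prime number and $x_{t+1}(v)=0$ otherwise. States are identified with their active sets $S_t=\{v\in V:x_t(v)=1\}\subseteq V$. For an initial active set $S_0\subseteq V$ with orbit $S_0,S_1,S_2,\dots$ (which is eventually periodic), the transient time $t(S_0)$ is the first time $t$ such that $S_t$ belongs to the final periodic orbit. The maximum transient time is $T(n)=\max_{S_0\subseteq V}t(S_0)$. *)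

(* Defs.v *)
From mathcomp Require Import all_boot.

Set Implicit Arguments.
Unset Strict Implicit.
Unset Printing Implicit Defensive.

Section EventuallyPeriodic.
Variables (T : finType) (f : T -> T).

(* [x] lies on a cycle of [f]: it is reachable from its own successor.  A point
   of the forward orbit of [x0] belongs to the final periodic orbit of [x0]
   exactly when it is periodic. *)
Definition periodic_point (x : T) : bool := fconnect f (f x) x.

Lemma eventually_periodic (x : T) : exists t, periodic_point (iter t f x).
Proof.
have /trajectP [i lt_i eq_i] := looping_order f x.
exists i; rewrite /periodic_point -iterS -[X in fconnect _ _ X]eq_i.
by rewrite -(subnK lt_i) iterD fconnect_iter.
Qed.

Definition transient_time (x : T) : nat := ex_minn (eventually_periodic x).

End EventuallyPeriodic.

Section Pulse.
Variables (V : finType) (E : rel V).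

(* A state x : V -> {0,1} is represented by its active set S, so that x u is
   the boolean [u \in S] read as a natural number. *)
Definition active_in_degree (S : {set V}) (v : V) : nat :=
  \sum_(u | E u v) (u \in S : nat).

Definition pulse (S : {set V}) : {set V} :=
  [set v | prime (active_in_degree S v)].

Definition max_transient_time : nat :=
  \max_(S : {set V}) transient_time pulse S.

End Pulse.

Definition complete_digraph (n : nat) : rel 'I_n := fun u v => u != v.
Arguments complete_digraph n : clear implicits.

(* Main.v *)
Require Import Defs.
From mathcomp Require Import all_boot all_order all_algebra.
From mathcomp Require Import all_classical all_reals all_analysis.
Import numFieldNormedType.Exports.
Import GRing.Theory Num.Theory.
Local Open Scope classical_set_scope.
Local Open Scope ring_scope.

(** On the complete loopless digraph every inactive vertex sees all #|S| active
    vertices and every active vertex sees all of them but itself.  One update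
    therefore depends only on the primality of #|S| - 1, which decides whether
    S survives, and of #|S|, which decides whether the complement of S fires
    (lemma [pulse_complete]).  So the new state is S, its complement, the full
    vertex set or the empty set (lemma [pulse_cases]).

    The empty set is fixed, and the full set, having an empty complement, is
    either fixed or mapped to the empty set; from these two states the periodic
    orbit is at most one step away.  A state mapped to itself is periodic.
    There remains the case where S is mapped to its complement.  The same
    alternative applied to the complement either leads back to S, so that S
    already lies on a 2-cycle, or leads to one of the three previous
    situations.  No transient is therefore longer than that of S, complement of
    S, full set, empty set, which takes 3 steps. *)

Section Transient.
Context {T : finType}.
Implicit Types (f : T -> T) (x : T).

Lemma transient_time_le f x k :
  periodic_point f (iter k f x) -> (transient_time f x <= k)%N.
Proof. by rewrite /transient_time; case: ex_minnP => m _ min_m /min_m. Qed.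

Lemma periodic_point_fixed f x : f x = x -> periodic_point f x.
Proof. by rewrite /periodic_point => ->; exact: connect0. Qed.

Lemma periodic_point_2cycle f x : f (f x) = x -> periodic_point f x.
Proof. by rewrite /periodic_point => {2}<-; exact: fconnect1. Qed.

End Transient.

Section CompleteDigraph.
Variable n : nat.
Implicit Type S : {set 'I_n}.
Local Notation f := (pulse (complete_digraph n)).

Lemma active_in_degree_complete S v :
  active_in_degree (complete_digraph n) S v = (#|S| - (v \in S))%N.
Proof.
rewrite (cardsD1 v S) addKn /active_in_degree -sum1_card [RHS]big_mkcond /=.
rewrite [LHS]big_mkcond /=; apply: eq_bigr => u _.
by rewrite in_setD1 /complete_digraph; case: (u != v) => //=; case: (u \in S).
Qed.

Lemma pulse_complete S :
  f S = (if prime #|S|.-1 then S else finset.set0)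
        :|: (if prime #|S| then ~: S else finset.set0).
Proof.
apply/finset.setP => v; rewrite finset.inE active_in_degree_complete.
case: (boolP (v \in S)) => vS; rewrite ?subn1 ?subn0;
  by do 2!case: ifP; rewrite !finset.inE ?vS ?(negPf vS).
Qed.

Lemma pulse_set0 : f finset.set0 = finset.set0.
Proof. by rewrite pulse_complete cards0 finset.setU0. Qed.

Lemma pulse_setT : f finset.setT = finset.setT \/ f finset.setT = finset.set0.
Proof.
rewrite pulse_complete finset.setCT if_same finset.setU0.
by case: ifP; [left | right].
Qed.

Lemma pulse_cases S :
  [\/ f S = S, f S = finset.set0, f S = finset.setT | f S = ~: S].
Proof.
rewrite pulse_complete.
case: ifP => _; case: ifP => _;
  rewrite ?finset.setU0 ?finset.set0U ?finset.setUCr.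
- exact: Or43.
- exact: Or41.
- exact: Or44.
- exact: Or42.
Qed.

Lemma transient_time_complete S : (transient_time f S <= 3)%N.
Proof.
have dead k : iter k f S = finset.set0 -> (transient_time f S <= k)%N.
  move=> e; apply: transient_time_le; rewrite e.
  exact/periodic_point_fixed/pulse_set0.
have full k : iter k f S = finset.setT -> (transient_time f S <= k.+1)%N.
  move=> e; case: pulse_setT => eT; last by apply: dead; rewrite iterS e.
  apply: leq_trans (leqnSn k); apply: transient_time_le.
  by rewrite e; exact: periodic_point_fixed.
have [fS|fS|fS|fS] := pulse_cases S.
- exact/(leq_trans _ (leq0n 3))/transient_time_le/periodic_point_fixed.
- exact: leq_trans (dead 1 fS) _.
- exact: leq_trans (full 1 fS) _.
have [fC|fC|fC|fC] := pulse_cases (~: S).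
- apply: (@leq_trans 1) => //; apply: transient_time_le.
  by rewrite /= fS; exact: periodic_point_fixed.
- by apply: (@leq_trans 2) => //; apply: dead; rewrite /= fS.
- by apply: full; rewrite /= fS.
- apply: (@leq_trans 0) => //; apply: transient_time_le.
  by apply: periodic_point_2cycle; rewrite fS fC finset.setCK.
Qed.

Lemma max_transient_time_complete :
  (max_transient_time (complete_digraph n) <= 3)%N.
Proof. by apply/bigmax_leqP => S _; exact: transient_time_complete. Qed.

End CompleteDigraph.

Theorem theorem14 (R : realType) :
  (forall n : nat, (max_transient_time (complete_digraph n) <= 3)%N)
  /\ (exists C : nat, forall n : nat,
        (max_transient_time (complete_digraph n) <= C)%N)
  /\ (fun n : nat => (max_transient_time (complete_digraph n))%:R : R)
       =O_\oo (fun _ : nat => 1 : R).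
Proof.
split; first exact: max_transient_time_complete.
split; first by exists 3%N; exact: max_transient_time_complete.
apply/eqO_exP; exists 3 => //.
apply: nearW => n.
by rewrite normr1 mulr1 normr_nat ler_nat max_transient_time_complete.
Qed.
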